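(* Consider the two-state pinching-antenna system described in the context, with pinching antennas (PAs) at $(x_k,0,h)$, $k=1,\dots,M$, user at $(x_m,y_m,0)$, and rectangular serving regions with left/right extents $L_k,R_k>0$. Put $C=\frac{\eta P_t}{\sigma^2}$ and $C_{0,k}=Ce^{-\alpha x_k}$. Then the ergodic rate $\overline R=\mathbb{E}[\log_2(1+\gamma)]$, where $\gamma$ is the SNR of the serving PA, equals $$\overline R=\sum_{k=1}^{M}\left(\frac{L_k\,C_{l,k}(L_k)}{D_x}+\frac{R_k\,C_{l,k}(R_k)}{D_x}\right),$$ where, for $\Delta>0$, $$C_{l,k}(\Delta)=\frac{2}{\Delta D_y\ln 2}\Big(I_i(C_{0,k}+h^2)+I_j(C_{0,k}+h^2)-I_i(h^2)-I_j(h^2)\Big),$$ and, for $x>0$ (with $I_i,I_j$ depending also on $\Delta$ and $D_y$), $$I_i(x)=\frac{\Delta D_y}{2}\ln\left(\frac{D_y^2}{4}+\Delta^2+x\right)-\Delta D_y+2\Delta\sqrt{\Delta^2+x}\,\tan^{-1}\left(\frac{D_y}{2\sqrt{x+\Delta^2}}\right),$$ $$\begin{aligned} I_j(x)={}&\left[\frac{D_y}{2}\sqrt{x+\frac{D_y^2}{4}}+x\ln\left(\frac{D_y}{2}+\sqrt{x+\frac{D_y^2}{4}}\right)\right]\tan^{-1}\left(\frac{\Delta}{\sqrt{x+\frac{D_y^2}{4}}}\right)-x\ln(\sqrt{x})\tan^{-1}\left(\frac{\Delta}{\sqrt{x}}\right)+\frac{\Delta D_y}{2}\\ &-\Delta\sqrt{x+\Delta^2}\,\tan^{-1}\left(\frac{D_y}{2\sqrt{x+\Delta^2}}\right)\\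 &+x\Bigg[\left(\ln(\sqrt{x})+\operatorname{asinh}\left(\frac{D_y}{2\sqrt{x}}\right)\right)\tan^{-1}\left(\frac{\sqrt{x+\frac{D_y^2}{4}}}{\Delta}\right)-\ln(\sqrt{x})\tan^{-1}\left(\frac{\sqrt{x}}{\Delta}\right)-\frac{\pi}{2}\operatorname{asinh}\left(\frac{D_y}{2\sqrt{x}}\right)\\ &\quad-\mathrm{Ti}_2\left(e^{\operatorname{asinh}\left(\frac{D_y}{2\sqrt{x}}\right)}\frac{\Delta}{\sqrt{x}}\left(\sqrt{1+\frac{x}{\Delta^2}}-1\right)\right)+\mathrm{Ti}_2\left(\frac{\Delta}{\sqrt{x}}\left(\sqrt{1+\frac{x}{\Delta^2}}-1\right)\right)\\ &\quad-\mathrm{Ti}_2\left(-e^{\operatorname{asinh}\left(\frac{D_y}{2\sqrt{x}}\right)}\frac{\Delta}{\sqrt{x}}\left(\sqrt{1+\frac{x}{\Delta^2}}+1\right)\right)+\mathrm{Ti}_2\left(-\frac{\Delta}{\sqrt{x}}\left(\sqrt{1+\frac{x}{\Delta^2}}+1\right)\right)\Bigg]. \end{aligned}$$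
   Context: Model. Let $D_x,D_y,h,\eta,P_t,\sigma^2>0$ and $\alpha\ge 0$ be real constants ($\eta$: reference path loss, $P_t$: transmit power, $\sigma^2$: noise variance, $\alpha$: waveguide attenuation coefficient), and let $M\ge1$ be an integer. A user is at the random point $(x_m,y_m,0)$, where $x_m$ is uniform on $[0,D_x]$, $y_m$ is uniform on $[-D_y/2,D_y/2]$, and $x_m,y_m$ are independent. A waveguide of length $D_x$ parallel to the $x$-axis at height $h$, fed at $(0,0,h)$, carries $M$ pinching antennas (PAs); the $k$-th is at $(x_k,0,h)$ with $x_k=\frac{2k-1}{2}\delta$, $\delta=D_x/M$, $k=1,\dots,M$. Exactly one PA is active at a time. If the $k$-th PA is active, the received SNR is $$\gamma^{(k)}=\frac{\eta P_t e^{-\alpha x_k}}{\sigma^2\left((x_m-x_k)^2+y_m^2+h^2\right)}.$$ Serving regions (rectangular model). The $k$-th PA serves the user exactly when the user lies in the rectangle $[x_k-L_k,\,x_k+R_k]\times[-D_y/2,D_y/2]$, where $L_k,R_k>0$ are given numbers (in general $L_k\ne R_k$) such that these rectangles tile the deployment area: $x_1-L_1=0$, $x_k+R_k=x_{k+1}-L_{k+1}$ for $1\le k<M$, and $x_M+R_M=D_x$ (shared boundaries have probability zero and are assigned arbitrarily). The SNR of the serving PA is $\gamma=\gamma^{(k)}$ when the user lies in the $k$-th rectangle. Thus, conditionally on the user lying in the left (respectively right) part of the $k$-th rectangle, the distance $\varepsilon=|x_m-x_k|$ is uniform on $[0,\Delta]$ with $\Delta=L_k$ (respectively $\Delta=R_k$),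 independently of $y_m$. Special functions. $\mathrm{Ti}_2(z)=\frac{\mathrm{Li}_2(jz)-\mathrm{Li}_2(-jz)}{2j}$ is the arctangent integral (inverse tangent integral), where $j$ is the imaginary unit and $\mathrm{Li}_2$ is the (principal branch of the) dilogarithm; for real $z$, $\mathrm{Ti}_2(z)=\int_0^z\frac{\tan^{-1}t}{t}\,dt$. $\operatorname{asinh}$ is the inverse hyperbolic sine and $\tan^{-1}$ the principal arctangent. *)

(* Defs.v *)
From HB Require Import structures.
From mathcomp Require Import all_boot all_order all_algebra.
From mathcomp Require Import all_classical all_reals all_analysis.

Set Implicit Arguments.
Unset Strict Implicit.
Unset Printing Implicit Defensive.

Import Order.TTheory GRing.Theory Num.Theory.
Import numFieldNormedType.Exports.

Local Open Scope classical_set_scope.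
Local Open Scope ring_scope.

Section special_functions.
Context {R : realType}.
Implicit Types x z : R.

Definition log2 x : R := ln x / ln 2.

Definition asinh x : R := ln (x + Num.sqrt (x ^+ 2 + 1)).

Lemma asinhK x : (expR (asinh x) - expR (- asinh x)) / 2 = x.
Proof.
have s_gt0 : 0 < Num.sqrt (x ^+ 2 + 1) by rewrite sqrtr_gt0 ltr_wpDl ?sqr_ge0.
have sqE : Num.sqrt (x ^+ 2 + 1) ^+ 2 = x ^+ 2 + 1.
  by rewrite sqr_sqrtr// addr_ge0 ?sqr_ge0.
have lt_xs : `|x| < Num.sqrt (x ^+ 2 + 1).
  by rewrite -sqrtr_sqr ltr_sqrt ?ltrDl// ltr_wpDl ?sqr_ge0.
have e_gt0 : 0 < x + Num.sqrt (x ^+ 2 + 1).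
  by rewrite -ltrBlDl sub0r (le_lt_trans _ lt_xs)// -normrN ler_norm.
rewrite expRN /asinh lnK ?posrE//.
have -> : (x + Num.sqrt (x ^+ 2 + 1))^-1 = Num.sqrt (x ^+ 2 + 1) - x.
  apply: (mulfI (lt0r_neq0 e_gt0)); rewrite divff ?lt0r_neq0//.
  by rewrite addrC mulrC -subr_sqr sqE addrAC subrr add0r.
by rewrite opprB addrACA subrr addr0 mulrDl -splitr.
Qed.

(* The arctangent integral at a real point, i.e. the integral of atan t / t
   from 0 to z, oriented when z < 0. The integrand is 0 at t = 0 by the
   convention 0^-1 = 0, which does not affect the integral.
   On the real line this is (Li_2(jz) - Li_2(-jz)) / (2j). *)
Definition Ti2 z : R :=
  if 0 <= z then \int[lebesgue_measure]_(t in `[0, z]) (atan t / t)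
  else - \int[lebesgue_measure]_(t in `[z, 0]) (atan t / t).

End special_functions.

Section probability_notions.
Context {d : measure_display} {T : measurableType d} {R : realType}.
Variable P : probability T R.

Definition uniformly_distributed (X : {RV P >-> R}) (a b : R) : Prop :=
  exists ab : a < b, forall A : set R, measurable A ->
    distribution P X A = uniform_prob ab A.

Definition independent_rv (X Y : {RV P >-> R}) : Prop :=
  forall A B : set R, measurable A -> measurable B ->
    P (X @^-1` A `&` Y @^-1` B) = (P (X @^-1` A) * P (Y @^-1` B))%E.

End probability_notions.

Section pinching_antennas.
Context {R : realType}.

(* Antennas and serving regions are indexed by k = 1, ..., M; the values of
   index-dependent data at other k : nat are irrelevant. *)
Definition pa_pos (Dx : R) (M k : nat) : R :=
  (2 * k%:R - 1) / 2 * (Dx / M%:R).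

Definition snr (eta Pt sigma2 alpha h xk xm ym : R) : R :=
  eta * Pt * expR (- alpha * xk) /
    (sigma2 * ((xm - xk) ^+ 2 + ym ^+ 2 + h ^+ 2)).

Definition rectangles_tile (Dx : R) (M : nat) (Le Ri : nat -> R) : Prop :=
  [/\ forall k, (1 <= k <= M)%N -> 0 < Le k /\ 0 < Ri k,
      pa_pos Dx M 1 - Le 1%N = 0,
      forall k, (1 <= k < M)%N ->
        pa_pos Dx M k + Ri k = pa_pos Dx M k.+1 - Le k.+1
    & pa_pos Dx M M + Ri M = Dx].

Definition deployment_area (Dx Dy : R) : set (R * R) :=
  `[0, Dx] `*` `[- (Dy / 2), Dy / 2].

Definition serving_rectangle (Dx Dy : R) (M : nat) (Le Ri : nat -> R)
    (k : nat) : set (R * R) :=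
  `[pa_pos Dx M k - Le k, pa_pos Dx M k + Ri k]
    `*` `[- (Dy / 2), Dy / 2].

(* s is the index of the serving antenna: when the user is in the deployment
   area, it is in the closed rectangle of antenna s. The rectangles overlap
   only in their common sides, where s may be either of the two indices, so s
   is determined outside a null event; it is unconstrained on the null event
   that the user is outside of the deployment area. *)
Definition serving_index (Dx Dy : R) (M : nat) (Le Ri : nat -> R) (T : Type)
    (xm ym : T -> R) (s : T -> nat) : Prop :=
  forall w, deployment_area Dx Dy (xm w, ym w) ->
    (1 <= s w <= M)%N /\
    serving_rectangle Dx Dy M Le Ri (s w) (xm w, ym w).

Definition I_i (Dy Delta x : R) : R :=
  Delta * Dy / 2 * ln (Dy ^+ 2 / 4 + Delta ^+ 2 + x) - Delta * Dy
  + 2 * Delta * Num.sqrt (Delta ^+ 2 + x)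
      * atan (Dy / (2 * Num.sqrt (x + Delta ^+ 2))).

Definition I_j (Dy Delta x : R) : R :=
  (Dy / 2 * Num.sqrt (x + Dy ^+ 2 / 4)
     + x * ln (Dy / 2 + Num.sqrt (x + Dy ^+ 2 / 4)))
    * atan (Delta / Num.sqrt (x + Dy ^+ 2 / 4))
  - x * ln (Num.sqrt x) * atan (Delta / Num.sqrt x)
  + Delta * Dy / 2
  - Delta * Num.sqrt (x + Delta ^+ 2)
      * atan (Dy / (2 * Num.sqrt (x + Delta ^+ 2)))
  + x *
    ((ln (Num.sqrt x) + asinh (Dy / (2 * Num.sqrt x)))
       * atan (Num.sqrt (x + Dy ^+ 2 / 4) / Delta)
     - ln (Num.sqrt x) * atan (Num.sqrt x / Delta)
     - pi / 2 * asinh (Dy / (2 * Num.sqrt x))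
     - Ti2 (expR (asinh (Dy / (2 * Num.sqrt x))) * (Delta / Num.sqrt x)
              * (Num.sqrt (1 + x / Delta ^+ 2) - 1))
     + Ti2 (Delta / Num.sqrt x * (Num.sqrt (1 + x / Delta ^+ 2) - 1))
     - Ti2 (- expR (asinh (Dy / (2 * Num.sqrt x))) * (Delta / Num.sqrt x)
              * (Num.sqrt (1 + x / Delta ^+ 2) + 1))
     + Ti2 (- (Delta / Num.sqrt x) * (Num.sqrt (1 + x / Delta ^+ 2) + 1))).

Definition C_l (Dy h C0 Delta : R) : R :=
  2 / (Delta * Dy * ln 2) *
    (I_i Dy Delta (C0 + h ^+ 2) + I_j Dy Delta (C0 + h ^+ 2)
     - I_i Dy Delta (h ^+ 2) - I_j Dy Delta (h ^+ 2)).

End pinching_antennas.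

(* Main.v *)
Require Import Defs.
From HB Require Import structures.
From mathcomp Require Import all_boot all_order all_algebra.
From mathcomp Require Import all_classical all_reals all_analysis.
From mathcomp Require Import measurable_realfun ring lra.

Set Implicit Arguments.
Unset Strict Implicit.
Unset Printing Implicit Defensive.

Import Order.TTheory GRing.Theory Num.Theory.
Import numFieldNormedType.Exports.

Local Open Scope classical_set_scope.
Local Open Scope ring_scope.

(* Write Phi(X) for the double integral of ln(u^2 + v^2 + X) over a rectangle.
   Since 1 + gamma = (N + C_0 + h^2) / (N + h^2) with N = (x_m - x_k)^2 + y_m^2,
   the contribution of one rectangle is a multiple of
   Phi(C_0 + h^2) - Phi(h^2), and Phi is evaluated by two applications of the
   fundamental theorem of calculus. Set b = D_y / 2, r = sqrt(u^2 + X) and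
   s = sqrt(X + b^2). After atan(s / u) = pi / 2 - atan(u / s) and the oddness
   of Ti_2, the closed form I_i + I_j collapses to
     u b ln(b^2 + u^2 + X) - b u + u r atan(b / r) + b s atan(u / s) + X T(u),
   where T is the sum of the four Ti_2 terms and T'(u) = atan(b / r) / r. This
   expression is smooth and, together with T, odd on the whole real line, so
   that a single primitive serves the left and the right part of a rectangle;
   it is a primitive of the inner integral up to the term 2 b u, which cancels
   in the difference of the values at C_0 + h^2 and h^2. *)

(** * Chain rules on the real line and the fundamental theorem of calculus *)

Section derivatives.
Context {R : realType}.
Implicit Types (f F : R -> R) (x a b df : R).

Lemma is_derive_ln_comp f x df : 0 < f x ->
  is_derive x 1 f df -> is_derive x 1 (fun y => ln (f y)) (df / f x).
Proof.
move=> fx0 fdf; rewrite mulrC.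
exact: (is_derive1_comp (is_derive1_ln fx0) fdf).
Qed.

Lemma is_derive_sqrt_comp f x df : 0 < f x -> is_derive x 1 f df ->
  is_derive x 1 (fun y => Num.sqrt (f y)) (df / (2 * Num.sqrt (f x))).
Proof.
move=> fx0 fdf; rewrite mulrC.
exact: (is_derive1_comp (is_derive1_sqrt fx0) fdf).
Qed.

Lemma is_derive_atan_comp f x df : is_derive x 1 f df ->
  is_derive x 1 (fun y => atan (f y)) (df / (1 + f x ^+ 2)).
Proof.
move=> fdf; rewrite mulrC.
exact: (is_derive1_comp (is_derive1_atan (f x)) fdf).
Qed.

Lemma is_derive_mul f F x df dF : is_derive x 1 f df -> is_derive x 1 F dF ->
  is_derive x 1 (fun y => f y * F y) (df * F x + f x * dF).
Proof.
move=> fdf FdF; apply: is_derive_eq (is_deriveM fdf FdF) _.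
by rewrite /GRing.scale/= addrC [F x * df]mulrC.
Qed.

Lemma is_derive_inv f x df : f x != 0 -> is_derive x 1 f df ->
  is_derive x 1 (fun y => (f y)^-1) (- df / f x ^+ 2).
Proof.
move=> fx0 fdf; apply: is_derive_eq (is_deriveV fx0 fdf) _.
by rewrite /GRing.scale/= mulrC mulrN mulNr.
Qed.

Lemma is_derive_continuous F (f : R -> R) :
  (forall x, is_derive x 1 F (f x)) -> continuous F.
Proof.
move=> dF x; apply: differentiable_continuous.
by apply/derivable1_diffP; case: (dF x).
Qed.

(** A function with a derivative everywhere is continuous, so the one-sided conditions of the second
    fundamental theorem at [a] and [b] come for free. *)
Lemma integral_is_derive F f a b : a < b -> continuous f ->
  (forall x, is_derive x 1 F (f x)) ->
  (\int[lebesgue_measure]_(x in `[a, b]) (f x)%:E = (F b - F a)%:E)%E.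
Proof.
move=> ab cf dF; have cF := is_derive_continuous dF.
rewrite EFinB; apply: continuous_FTC2 => //.
- exact: continuous_subspaceT.
- split => [x _||].
  + by case: (dF x).
  + exact: cvg_at_right_filter (cF a).
  + exact: cvg_at_left_filter (cF b).
- by move=> x _; rewrite derive1E; case: (dF x).
Qed.

End derivatives.

(** * The arctangent integral: oddness and derivative *)

Section arctangent_integral.
Context {R : realType}.
Implicit Types x z : R.

(* The integrand of Ti2 is discontinuous at 0 because 0^-1 = 0. *)
Definition atan_div z : R := if z == 0 then 1 else atan z / z.

(** At 0 this is the slope of [atan] from the origin, completed by the derivative 1: it is the
    Caratheodory factor [g], which is continuous there. Elsewhere it agrees locally with a quotient
    of continuous functions. *)
Lemma continuous_atan_div : continuous atan_div.
Proof.
move=> x; have [->|x0] := eqVneq x 0.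
  have [g [gE cg g0]] := (is_derive1_caratheodory _ _ _).1 (is_derive1_atan (0 : R)).
  suff -> : atan_div = g by [].
  apply/funext => z; rewrite /atan_div; case: eqVneq => [->|z0].
    by rewrite g0 expr0n/= addr0 invr1.
  by have := gE z; rewrite atan0 !subr0 => ->; rewrite mulfK.
have cx : (fun z => atan z / z) @ x --> atan x / x.
  by apply: cvgM; [exact: continuous_atan|exact: cvgV].
rewrite /continuous_at {2}/atan_div (negbTE x0); apply: cvg_trans cx.
apply: near_eq_cvg; near=> z; rewrite /atan_div; case: eqVneq => // z0.
exfalso; have : z != 0 by near: z; exact: (@open_neq _ 0).
by rewrite z0 eqxx.
Unshelve. all: by end_near. Qed.

Local Notation mu := (@lebesgue_measure R).

Lemma integrable_atan_div a b : mu.-integrable `[a, b] (EFin \o atan_div).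
Proof.
apply: continuous_compact_integrable; first exact: segment_compact.
exact/continuous_subspaceT/continuous_atan_div.
Qed.

Lemma atan_divN z : atan_div (- z) = atan_div z.
Proof. by rewrite /atan_div oppr_eq0 atanN invrN mulrNN. Qed.

(** The two integrands differ only at 0, and dropping this end point changes neither integral. *)
Lemma Ti2_ge0E z : 0 <= z -> Ti2 z = \int[mu]_(t in `[0, z]) atan_div t.
Proof.
move=> z0; rewrite /Ti2 z0.
have f0 t : t \in `]0, z] -> atan_div t = atan t / t.
  by rewrite in_itv/= /atan_div => /andP[t0 _]; rewrite gt_eqF.
have i0 : mu.-integrable `]0, z] (EFin \o atan_div).
  apply: integrableS (integrable_atan_div 0 z) => //.
  exact: subset_itv_oc_cc.
rewrite -!Rintegral_itv_obnd_cbnd//.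
  by apply: eq_Rintegral => t /[!inE] /f0.
apply: eq_integrable i0 => // t /[!inE] /f0 /= -> //.
Qed.

(** Since [atan_div] is even, the substitution of [- t] for [t] carries one branch of [Ti2] to the
    other. *)
Lemma Ti2N z : 0 < z -> Ti2 (- z) = - Ti2 z.
Proof.
move=> z0; rewrite (@Ti2_ge0E z) ?ltW// /Ti2 oppr_ge0 leNgt z0/=; congr (- _).
have f0 t : t \in `[- z, 0[ -> atan_div t = atan t / t.
  by rewrite in_itv/= /atan_div => /andP[_ t0]; rewrite lt_eqF.
have i0 : mu.-integrable `[- z, 0[ (EFin \o atan_div).
  apply: integrableS (integrable_atan_div (- z) 0) => //.
  exact: subset_itv_co_cc.
rewrite -Rintegral_itv_bndo_bndc//; last first.
  by apply: eq_integrable i0 => // t /[!inE] /f0 /= ->.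
transitivity (\int[mu]_(t in `[- z, - 0[) atan_div t).
  by rewrite oppr0; apply: eq_Rintegral => t /[!inE] /f0.
rewrite Rintegral_itv_bndo_bndc ?oppr0// -[in LHS]oppr0 /Rintegral; congr fine.
rewrite integration_by_substitution_oppr ?ltW//; last first.
  exact/continuous_subspaceT/continuous_atan_div.
by apply: eq_integral => t _ /=; rewrite atan_divN.
Qed.

Lemma is_derive_Ti2 z : 0 < z -> is_derive z 1 (@Ti2 R) (atan z / z).
Proof.
move=> z0.
(* An upper bound beyond [z] makes [z] interior to the interval of integration. *)
have z1 : z < z + 1 by rewrite ltrDl.
have [dG GE] := continuous_FTC1_closed z1 (integrable_atan_div 0 (z + 1)) z0
  (@continuous_atan_div z).
apply: (@near_eq_is_derive _ _ _ (fun x => \int[mu]_(t in `[0, x]) atan_div t)).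
- near=> x; apply/esym/Ti2_ge0E/ltW; near: x; exact: lt_nbhsr.
- by apply: DeriveDef => //; rewrite -derive1E GE /atan_div gt_eqF.
Unshelve. all: by end_near. Qed.

Lemma is_derive_Ti2_comp (f : R -> R) x df : 0 < f x -> is_derive x 1 f df ->
  is_derive x 1 (fun y => Ti2 (f y)) (df * (atan (f x) / f x)).
Proof.
move=> fx0 fdf; rewrite mulrC.
exact: (is_derive1_comp (is_derive_Ti2 fx0) fdf).
Qed.

End arctangent_integral.

(** * Complement and addition formulas for the arctangent *)

Section atan_addition.
Context {R : realType}.
Implicit Types x y : R.

Lemma atan_gt0 x : 0 < x -> 0 < atan x.
Proof. by move=> x0; rewrite -(@atan0 R) lt_atan. Qed.

Lemma atanV x : 0 < x -> atan x^-1 = pi / 2 - atan x.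
Proof.
move=> x0; have a0 := atan_gt0 x0; have a1 := atan_ltpi2 x.
have p0 := pi_gt0 R.
rewrite -[RHS]tanK; last by rewrite in_itv/=; apply/andP; split; lra.
congr atan; rewrite -{1}(atanK x) /tan sinB cosB.
rewrite sin_pihalf cos_pihalf !mul1r !mul0r subr0 add0r.
by rewrite invf_div.
Qed.

(** The condition gives [x < y^-1], hence [atan x < pi / 2 - atan y]: the sum of the angles stays in
    the range where [atan] inverts [tan]. *)
Lemma atanD x y : 0 < x -> 0 < y -> x * y < 1 ->
  atan x + atan y = atan ((x + y) / (1 - x * y)).
Proof.
move=> x0 y0 xy1.
have x1 : x < y^-1 by rewrite -(ltr_pM2r y0) mulVf ?gt_eqF.
have := lt_atan x1; rewrite atanV// => axy.
have ax0 := atan_gt0 x0; have ay0 := atan_gt0 y0.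
have p0 := pi_gt0 R.
have cx : cos (atan x) != 0.
  by rewrite gt_eqF// cos_gt0_pihalf// atan_gtNpi2 atan_ltpi2.
have cy : cos (atan y) != 0.
  by rewrite gt_eqF// cos_gt0_pihalf// atan_gtNpi2 atan_ltpi2.
rewrite -[LHS]tanK; last by rewrite in_itv/=; apply/andP; split; lra.
by rewrite tanD// !atanK.
Qed.

End atan_addition.

(** * The arctangent-integral part of the closed form and its derivative *)

Section closed_form.
Context {R : realType}.
Variables (b x : R).
Hypotheses (b0 : 0 < b) (x0 : 0 < x).
Implicit Types u v : R.

Definition radius u := Num.sqrt (u ^+ 2 + x).

Local Notation r := radius.
Local Notation k := (Num.sqrt x).
Local Notation s := (Num.sqrt (x + b ^+ 2)).
(* A = exp (asinh (b / sqrt x)). *)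
Local Notation A := ((b + s) / k).

Let k_gt0 : 0 < k. Proof. by rewrite sqrtr_gt0. Qed.

Let k2 : k ^+ 2 = x. Proof. by rewrite sqr_sqrtr ?ltW. Qed.

Let s_gt0 : 0 < s. Proof. by rewrite sqrtr_gt0 ltr_pwDl ?sqr_ge0. Qed.

Let s2 : s ^+ 2 = x + b ^+ 2.
Proof. by rewrite sqr_sqrtr// addr_ge0 ?sqr_ge0 ?ltW. Qed.

Let A_gt0 : 0 < A. Proof. by rewrite divr_gt0// addr_gt0. Qed.

Lemma radius_gt0 u : 0 < r u.
Proof. by rewrite sqrtr_gt0 ltr_wpDl ?sqr_ge0. Qed.

Lemma radius_sqr u : r u ^+ 2 = u ^+ 2 + x.
Proof. by rewrite sqr_sqrtr// addr_ge0 ?sqr_ge0 ?ltW. Qed.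

Lemma radiusN u : r (- u) = r u.
Proof. by rewrite /radius sqrrN. Qed.

Lemma is_derive_radius u : is_derive u 1 r (u / r u).
Proof.
have d2 : is_derive u 1 (fun y : R => y ^+ 2 + x) (2 * u).
  by apply: is_derive_eq; rewrite /GRing.scale/=; ring.
apply: is_derive_eq (is_derive_sqrt_comp _ d2) _.
  by rewrite ltr_wpDl ?sqr_ge0.
by rewrite -/(r u); field; rewrite gt_eqF ?radius_gt0.
Qed.

Lemma norm_lt_radius u : `|u| < r u.
Proof. by rewrite -sqrtr_sqr ltr_sqrt ?ltrDl// ltr_wpDl ?sqr_ge0. Qed.

(* This is exp (- asinh (u / sqrt x)); its reciprocal is the value at - u. *)
Definition expN_asinh u := (r u - u) / k.

Local Notation p := expN_asinh.

Lemma expN_asinh_gt0 u : 0 < p u.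
Proof.
by rewrite divr_gt0// subr_gt0 (le_lt_trans _ (norm_lt_radius u))// ler_norm.
Qed.

Lemma expN_asinhN u : p (- u) = (p u)^-1.
Proof.
apply/esym/(mulfI (lt0r_neq0 (expN_asinh_gt0 u))).
rewrite divff ?lt0r_neq0 ?expN_asinh_gt0// /expN_asinh radiusN.
have -> : (r u - u) / k * ((r u - - u) / k) = (r u ^+ 2 - u ^+ 2) / k ^+ 2.
  by field; rewrite gt_eqF.
by rewrite radius_sqr k2 addrAC subrr add0r divff ?gt_eqF.
Qed.

Lemma is_derive_expN_asinh u : is_derive u 1 p (- p u / r u).
Proof.
have ? := radius_gt0 u.
have d1 : is_derive u 1 (fun y => r y - y) (u / r u - 1).
  by apply: is_deriveB; exact: is_derive_radius.
apply: is_derive_eq (is_derive_mul d1 (is_derive_cst k^-1 u 1)) _.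
by rewrite /expN_asinh /= mulr0 addr0; field; rewrite !gt_eqF.
Qed.

Lemma is_derive_expN_asinhN u :
  is_derive u 1 (fun y => p (- y)) (p (- u) / r u).
Proof.
have ? := radius_gt0 u.
have dN : is_derive u 1 (-%R : R -> R) (-1) by apply: is_derive_eq.
apply: is_derive_eq (is_derive1_comp (is_derive_expN_asinh (- u)) dN) _.
by rewrite radiusN; field; rewrite gt_eqF.
Qed.

(* Pass to reciprocals and apply the addition formula: p u * p (- u) = 1,
   p u + p (- u) = 2 r / sqrt x and A - A^-1 = 2 b / sqrt x. *)
Lemma atan_expN_asinh_sum u :
  atan (A * p (- u)) - atan (p (- u)) + (atan (A * p u) - atan (p u)) =
  atan (b / r u).
Proof.
have p0 := expN_asinh_gt0 u; have q0 := expN_asinh_gt0 (- u).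
have r0 := radius_gt0 u.
have bs0 : 0 < b + s by rewrite addr_gt0.
have pqA : (A^-1 * p u) * (A^-1 * p (- u)) = A^-1 ^+ 2.
  by rewrite mulrACA [p u * _]mulrC expN_asinhN mulVf ?gt_eqF// mulr1.
(* Here [A > 1] because [s > k]; by [pqA] this is the condition under which [atanD] applies. *)
have A1 : A^-1 ^+ 2 < 1.
  rewrite expr_lt1// ?invr_ge0 ?ltW// invf_lt1//.
  rewrite ltr_pdivlMr// mul1r ltr_wpDl ?ltW//.
  by rewrite ltr_sqrt ?ltrDl ?exprn_gt0// addr_gt0// exprn_gt0.
have eA y : 0 < y -> atan (A * y) = pi / 2 - atan (A^-1 * y^-1).
  by move=> y0; have := atanV (mulr_gt0 A_gt0 y0); rewrite invfM => ->; ring.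
have pN : (p (- u))^-1 = p u by rewrite expN_asinhN invrK.
rewrite !eA// pN -expN_asinhN.
have -> : atan (p (- u)) = pi / 2 - atan (p u) by rewrite expN_asinhN atanV.
have -> : atan (b / r u) = pi / 2 - atan (r u / b).
  by rewrite -atanV ?divr_gt0// invf_div.
have Ai0 : 0 < A^-1 by rewrite invr_gt0.
have := atanD (mulr_gt0 Ai0 p0) (mulr_gt0 Ai0 q0); rewrite pqA => /(_ A1).
have -> : (A^-1 * p u + A^-1 * p (- u)) / (1 - A^-1 ^+ 2) = r u / b.
  rewrite /expN_asinh radiusN.
  have -> : 1 - A^-1 ^+ 2 = 2 * b / (b + s).
    rewrite -[RHS]divr1 -[LHS]divr1; apply/eqP; rewrite eqr_div ?oner_eq0// !mulr1.
    have -> : 1 - A^-1 ^+ 2 = ((b + s) ^+ 2 - k ^+ 2) / (b + s) ^+ 2.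
      by field; rewrite !gt_eqF.
    have -> : (b + s) ^+ 2 - k ^+ 2 = 2 * b * (b + s).
      rewrite k2; move: (s) s2 => S sS.
      have -> : x = S ^+ 2 - b ^+ 2 by rewrite sS addrK.
      ring.
    by apply/eqP; field; rewrite gt_eqF.
  by field; rewrite !gt_eqF.
lra.
Qed.

(** The four [Ti2] terms of [I_j], with signs moved out by oddness. All arguments are positive for
    every real [u], where the derivative of [Ti2] is known. *)
Definition Ti2_sum u :=
  Ti2 (A * p (- u)) - Ti2 (p (- u)) - (Ti2 (A * p u) - Ti2 (p u)).

Lemma Ti2_sumN u : Ti2_sum (- u) = - Ti2_sum u.
Proof. by rewrite /Ti2_sum opprK; ring. Qed.

(** As the logarithmic derivatives of [p u] and [p (- u)] are [- 1 / r u] and [1 / r u], each term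
    contributes an arctangent over [r u]; [atan_expN_asinh_sum] adds the four. *)
Lemma is_derive_Ti2_sum u : is_derive u 1 Ti2_sum (atan (b / r u) / r u).
Proof.
have p0 := expN_asinh_gt0 u; have q0 := expN_asinh_gt0 (- u).
have r0 := radius_gt0 u.
have d1 := is_derive_expN_asinh u; have d2 := is_derive_expN_asinhN u.
have d1A := is_derive_mul (is_derive_cst A u 1) d1.
have d2A := is_derive_mul (is_derive_cst A u 1) d2.
have e1 := is_derive_Ti2_comp p0 d1.
have e2 := @is_derive_Ti2_comp _ (fun y => p (- y)) _ _ q0 d2.
have e1A := @is_derive_Ti2_comp _ (fun y => A * p y) _ _ (mulr_gt0 A_gt0 p0) d1A.
have e2A := @is_derive_Ti2_comp _ (fun y => A * p (- y)) _ _ (mulr_gt0 A_gt0 q0) d2A.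
apply: is_derive_eq (is_deriveB (is_deriveB e2A e2) (is_deriveB e1A e1)) _.
rewrite -atan_expN_asinh_sum /=.
have bs0 : 0 < b + s by rewrite addr_gt0.
by field; rewrite !gt_eqF.
Qed.

End closed_form.

(** * Primitives for the double integral of the logarithm *)

Section log_antiderivatives.
Context {R : realType}.
Implicit Types b x u v : R.

(** Integration by parts in [v] leaves 2 v^2 / N = 2 - 2 r^2 / N, where N = v^2 + r^2 and r =
    [radius x u]. *)
Definition ln_primitive x u v :=
  v * ln (u ^+ 2 + v ^+ 2 + x) - 2 * v + 2 * radius x u * atan (v / radius x u).

(** The coefficient 3, instead of the 1 of the closed form, makes this an exact primitive of
    [ln_primitive x u b] in [u]. *)
Definition ln_double_primitive b x u :=
  u * b * ln (b ^+ 2 + u ^+ 2 + x) - 3 * b * u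
  + u * radius x u * atan (b / radius x u)
  + b * Num.sqrt (x + b ^+ 2) * atan (u / Num.sqrt (x + b ^+ 2))
  + x * Ti2_sum b x u.

Lemma ln_primitiveN x u v : ln_primitive x u (- v) = - ln_primitive x u v.
Proof. by rewrite /ln_primitive sqrrN !mulNr atanN; ring. Qed.

Lemma ln_double_primitiveN b x u :
  ln_double_primitive b x (- u) = - ln_double_primitive b x u.
Proof.
by rewrite /ln_double_primitive sqrrN radiusN Ti2_sumN !mulNr atanN; ring.
Qed.

Lemma sum_sqr_gt0 x u v : 0 < x -> 0 < u ^+ 2 + v ^+ 2 + x.
Proof. by move=> x0; rewrite ltr_wpDl// addr_ge0// sqr_ge0. Qed.

Lemma is_derive_ln_sum_sqr x u v : 0 < x ->
  is_derive v 1 (fun y => ln (u ^+ 2 + y ^+ 2 + x))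
    (2 * v / (u ^+ 2 + v ^+ 2 + x)).
Proof.
move=> x0.
apply: (@is_derive_ln_comp _ (fun y => u ^+ 2 + y ^+ 2 + x)).
  exact: sum_sqr_gt0.
by apply: is_derive_eq; rewrite /GRing.scale/=; ring.
Qed.

Lemma is_derive_ln_primitive x u v : 0 < x ->
  is_derive v 1 (ln_primitive x u) (ln (u ^+ 2 + v ^+ 2 + x)).
Proof.
move=> x0; have N0 := sum_sqr_gt0 u v x0.
have r0 := radius_gt0 x0 u; have r2 := radius_sqr x0 u.
have dl := is_derive_ln_sum_sqr u v x0.
have da : is_derive v 1 (fun y => atan (y / radius x u))
    (radius x u / (u ^+ 2 + v ^+ 2 + x)).
  have dv := is_derive_mul (is_derive_id v 1) (is_derive_cst (radius x u)^-1 v 1).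
  apply: is_derive_eq (is_derive_atan_comp dv) _.
  have -> : u ^+ 2 + v ^+ 2 + x = radius x u ^+ 2 + v ^+ 2 by rewrite r2; ring.
  rewrite /= mulr0 addr0; field.
  by rewrite !gt_eqF// ltr_pwDl ?exprn_gt0// ?sqr_ge0.
have d1 := is_derive_mul (is_derive_id v 1) dl.
have d2 := is_derive_mul (is_derive_cst (2 : R) v 1) (is_derive_id v 1).
have d3 := is_derive_mul (is_derive_cst (2 * radius x u : R) v 1) da.
apply: is_derive_eq (is_deriveD (is_deriveB d1 d2) d3) _.
move: N0; have -> : u ^+ 2 + v ^+ 2 + x = radius x u ^+ 2 + v ^+ 2.
  by rewrite r2; ring.
by move=> N0 /=; field; rewrite !gt_eqF.
Qed.

(** With N = b^2 + u^2 + x, the rational terms 2 b u^2 / N, - b u^2 / N and b (x + b^2) / N add up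
    to b, which turns - 3 b into the - 2 b of [ln_primitive]. *)
Lemma is_derive_ln_double_primitive b x u : 0 < b -> 0 < x ->
  is_derive u 1 (ln_double_primitive b x) (ln_primitive x u b).
Proof.
move=> b0 x0; have N0 := sum_sqr_gt0 b u x0.
have r0 := radius_gt0 x0 u; have r2 := radius_sqr x0 u.
have s0 : 0 < Num.sqrt (x + b ^+ 2) by rewrite sqrtr_gt0 ltr_pwDl ?sqr_ge0.
have s2 : Num.sqrt (x + b ^+ 2) ^+ 2 = x + b ^+ 2.
  by rewrite sqr_sqrtr// addr_ge0 ?sqr_ge0 ?ltW.
have dl := is_derive_ln_sum_sqr b u x0.
have dr := is_derive_radius x0 u.
have da : is_derive u 1 (fun y => atan (b / radius x y))
    (- (b * u) / (radius x u * (b ^+ 2 + u ^+ 2 + x))).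
  have dV := is_derive_inv (lt0r_neq0 r0) dr.
  have db := is_derive_mul (is_derive_cst b u 1) dV.
  apply: is_derive_eq (is_derive_atan_comp db) _.
  have -> : b ^+ 2 + u ^+ 2 + x = radius x u ^+ 2 + b ^+ 2 by rewrite r2; ring.
  rewrite /=; field.
  by rewrite !gt_eqF// ltr_pwDl ?exprn_gt0// ?sqr_ge0.
have ds : is_derive u 1 (fun y => atan (y / Num.sqrt (x + b ^+ 2)))
    (Num.sqrt (x + b ^+ 2) / (b ^+ 2 + u ^+ 2 + x)).
  have du := is_derive_mul (is_derive_id u 1)
    (is_derive_cst (Num.sqrt (x + b ^+ 2))^-1 u 1).
  apply: is_derive_eq (is_derive_atan_comp du) _.
  have -> : b ^+ 2 + u ^+ 2 + x = Num.sqrt (x + b ^+ 2) ^+ 2 + u ^+ 2.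
    by rewrite s2; ring.
  rewrite /= mulr0 addr0; field.
  by rewrite !gt_eqF// ltr_pwDl ?exprn_gt0// ?sqr_ge0.
have d1 := is_derive_mul
  (is_derive_mul (is_derive_id u 1) (is_derive_cst b u 1)) dl.
have d2 := is_derive_mul (is_derive_cst (3 * b : R) u 1) (is_derive_id u 1).
have d3 := is_derive_mul (is_derive_mul (is_derive_id u 1) dr) da.
have d4 := is_derive_mul (is_derive_cst (b * Num.sqrt (x + b ^+ 2) : R) u 1) ds.
have d5 := is_derive_mul (is_derive_cst x u 1) (is_derive_Ti2_sum b0 x0 u).
apply: is_derive_eq
  (is_deriveD (is_deriveD (is_deriveD (is_deriveB d1 d2) d3) d4) d5) _.
rewrite /ln_primitive /= [u ^+ 2 + b ^+ 2]addrC.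
have -> : b * Num.sqrt (x + b ^+ 2) * (Num.sqrt (x + b ^+ 2) / (b ^+ 2 + u ^+ 2 + x))
    = b * (x + b ^+ 2) / (b ^+ 2 + u ^+ 2 + x) by rewrite -[in RHS]s2; field; rewrite gt_eqF.
(* The coefficients of atan(b / r) are r + u^2 / r and, from [Ti2_sum], x / r; with x = r^2 - u^2
   they add up to 2 r. *)
have xE : x = radius x u ^+ 2 - u ^+ 2 by rewrite r2 addrAC subrr add0r.
rewrite !mul0r !add0r.
have -> : x * (atan (b / radius x u) / radius x u) =
    (radius x u ^+ 2 - u ^+ 2) * (atan (b / radius x u) / radius x u) by rewrite -xE.
by field; rewrite !gt_eqF.
Qed.

End log_antiderivatives.

(** * Agreement of the primitive with the stated closed form *)

Section closed_form_agreement.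
Context {R : realType}.
Implicit Types b x D : R.

Lemma asinh_div_sqrt b x : 0 < b -> 0 < x ->
  asinh (b / Num.sqrt x) = ln (b + Num.sqrt (x + b ^+ 2)) - ln (Num.sqrt x).
Proof.
move=> b0 x0; have k0 : 0 < Num.sqrt x by rewrite sqrtr_gt0.
have s0 : 0 < Num.sqrt (x + b ^+ 2) by rewrite sqrtr_gt0 ltr_pwDl ?sqr_ge0.
rewrite /asinh -ln_div ?posrE ?addr_gt0//; congr ln.
have -> : (b / Num.sqrt x) ^+ 2 + 1 = (x + b ^+ 2) / Num.sqrt x ^+ 2.
  by rewrite expr_div_n sqr_sqrtr ?ltW//; field; rewrite gt_eqF.
rewrite sqrtrM ?addr_ge0 ?sqr_ge0 ?ltW// sqrtrV ?sqr_ge0// sqrtr_sqr gtr0_norm//.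
by rewrite mulrDl.
Qed.

(** Once [asinh] is a difference of logarithms and each [atan (y / D)] is [pi / 2 - atan (D / y)],
    all logarithms of [I_j] cancel. The term [2 * b * D] offsets the coefficient 3. *)
Lemma I_iD_I_jE b D x : 0 < b -> 0 < D -> 0 < x ->
  I_i (2 * b) D x + I_j (2 * b) D x = ln_double_primitive b x D + 2 * b * D.
Proof.
move=> b0 D0 x0; have k0 : 0 < Num.sqrt x by rewrite sqrtr_gt0.
have s0 : 0 < Num.sqrt (x + b ^+ 2) by rewrite sqrtr_gt0 ltr_pwDl ?sqr_ge0.
have r0 := radius_gt0 x0 D.
have q0 := expN_asinh_gt0 x0 (- D).
have bs0 : 0 < b + Num.sqrt (x + b ^+ 2) by rewrite addr_gt0.
rewrite /I_i /I_j.
have -> : (2 * b) ^+ 2 / 4 = b ^+ 2 by field.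
have -> : 2 * b / 2 = b by field.
have e2 y : 2 * b / (2 * y) = b / y.
  by rewrite -mulf_div divff ?mul1r// pnatr_eq0.
rewrite !e2 asinh_div_sqrt//.
rewrite [x + D ^+ 2]addrC -/(radius x D).
have -> : expR (ln (b + Num.sqrt (x + b ^+ 2)) - ln (Num.sqrt x)) =
    (b + Num.sqrt (x + b ^+ 2)) / Num.sqrt x.
  by rewrite -ln_div ?posrE// lnK// posrE divr_gt0.
have -> : Num.sqrt (1 + x / D ^+ 2) = radius x D / D.
  have -> : 1 + x / D ^+ 2 = (D ^+ 2 + x) / D ^+ 2 by field; rewrite gt_eqF.
  rewrite sqrtrM ?addr_ge0 ?sqr_ge0 ?ltW// sqrtrV ?sqr_ge0// sqrtr_sqr.
  by rewrite gtr0_norm.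
(* The [Ti2] arguments are, up to sign and the factor A, [expN_asinh] at [D] and at [- D]. *)
have eq1 : D / Num.sqrt x * (radius x D / D - 1) = expN_asinh x D.
  by rewrite /expN_asinh; field; rewrite !gt_eqF.
have eq2 : D / Num.sqrt x * (radius x D / D + 1) = expN_asinh x (- D).
  by rewrite /expN_asinh radiusN; field; rewrite !gt_eqF.
have eq3 y : y * (D / Num.sqrt x) * (radius x D / D - 1) = y * expN_asinh x D.
  by rewrite -mulrA eq1.
have eq4 y : - y * (D / Num.sqrt x) * (radius x D / D + 1) =
    - (y * expN_asinh x (- D)).
  by rewrite -mulrA eq2 mulNr.
rewrite eq3 eq4 eq1 mulNr eq2.
have A0 := divr_gt0 bs0 k0.
rewrite (Ti2N q0) (Ti2N (mulr_gt0 A0 q0)).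
have eV y : 0 < y -> atan (y / D) = pi / 2 - atan (D / y).
  by move=> y0; rewrite -atanV ?divr_gt0// invf_div.
by rewrite !eV// /ln_double_primitive /Ti2_sum; field.
Qed.

End closed_form_agreement.

(** * Integrals of the rate over the ordinate and then the abscissa *)

Section rate_integrals.
Context {R : realType}.
Implicit Types b x u v : R.

Lemma continuous_ln_primitive b x : 0 < x ->
  continuous (fun u => ln_primitive x u b).
Proof.
move=> x0 u; apply: differentiable_continuous; apply/derivable1_diffP.
have r0 := radius_gt0 x0 u; have dr := is_derive_radius x0 u.
have dl : is_derive u 1 (fun y : R => ln (y ^+ 2 + b ^+ 2 + x))
    (2 * u / (b ^+ 2 + u ^+ 2 + x)).
  under eq_fun do rewrite [_ ^+ 2 + b ^+ 2]addrC.
  exact: is_derive_ln_sum_sqr.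
have dV := is_derive_inv (lt0r_neq0 r0) dr.
have db := is_derive_mul (is_derive_cst b u 1) dV.
have d1 := is_derive_mul (is_derive_cst b u 1) dl.
have d2 := is_derive_mul (is_derive_cst (2 : R) u 1) (is_derive_cst b u 1).
have d3 := is_derive_mul (is_derive_mul (is_derive_cst (2 : R) u 1) dr)
  (is_derive_atan_comp db).
by have [] := is_deriveD (is_deriveB d1 d2) d3.
Qed.

Lemma continuous_ln_sum_sqr x u : 0 < x ->
  continuous (fun v => ln (u ^+ 2 + v ^+ 2 + x)).
Proof. by move=> x0; apply: is_derive_continuous => v; exact: is_derive_ln_sum_sqr. Qed.

Lemma log2_snr_ratio C x u v : 0 < C -> 0 < x ->
  log2 (1 + C / (u ^+ 2 + v ^+ 2 + x)) =
  (ln (u ^+ 2 + v ^+ 2 + (C + x)) - ln (u ^+ 2 + v ^+ 2 + x)) / ln 2.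
Proof.
move=> C0 x0; have N0 := sum_sqr_gt0 u v x0.
have N1 := sum_sqr_gt0 u v (addr_gt0 C0 x0).
rewrite /log2 -ln_div ?posrE//; congr (ln _ / _).
by field; rewrite gt_eqF.
Qed.

Lemma integral_log2_snr_ratio C x b u : 0 < C -> 0 < x -> 0 < b ->
  (\int[lebesgue_measure]_(v in `[(- b)%R, b])
     (log2 (1 + C / (u ^+ 2 + v ^+ 2 + x)))%:E =
   (2 * (ln_primitive (C + x) u b - ln_primitive x u b) / ln 2)%:E)%E.
Proof.
move=> C0 x0 b0; have Cx0 := addr_gt0 C0 x0.
under eq_integral do rewrite log2_snr_ratio//.
pose F v := (ln_primitive (C + x) u v - ln_primitive x u v) * (ln 2)^-1.
pose f v := (ln (u ^+ 2 + v ^+ 2 + (C + x)) - ln (u ^+ 2 + v ^+ 2 + x)) / ln 2.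
have cf : continuous f.
  move=> v; apply: cvgM; last exact: cvg_cst.
  by apply: cvgB; exact: continuous_ln_sum_sqr.
have dF (v : R) : is_derive v 1 F (f v).
  have d1 := is_derive_ln_primitive u v Cx0.
  have d2 := is_derive_ln_primitive u v x0.
  apply: is_derive_eq (is_derive_mul (is_deriveB d1 d2)
    (is_derive_cst (ln 2)^-1 v 1)) _.
  by rewrite mulr0 addr0.
rewrite (integral_is_derive (gtrN b0) cf dF) /F !ln_primitiveN.
by congr EFin; ring.
Qed.

Lemma continuous_ln_primitive_diff C x b xi : 0 < C -> 0 < x ->
  continuous (fun t => 2 *
    (ln_primitive (C + x) (t - xi) b - ln_primitive x (t - xi) b) / ln 2).
Proof.
move=> C0 x0 t; apply: cvgM; last exact: cvg_cst.
apply: cvgM; first exact: cvg_cst.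
have ct : (fun y => y - xi) @ t --> t - xi by apply: cvgB => //; exact: cvg_cst.
have cl y : 0 < y ->
    (fun z => ln_primitive y (z - xi) b) @ t --> ln_primitive y (t - xi) b.
  by move=> y0; exact: (cvg_comp _ _ ct (@continuous_ln_primitive b y y0 _)).
by apply: cvgB; apply: cl => //; rewrite addr_gt0.
Qed.

Lemma integral_ln_primitive_diff C x b xi L r :
  0 < C -> 0 < x -> 0 < b -> 0 < L -> 0 < r ->
  (\int[lebesgue_measure]_(t in `[(xi - L)%R, (xi + r)%R])
     (2 * (ln_primitive (C + x) (t - xi) b - ln_primitive x (t - xi) b)
       / ln 2)%:E =
   (2 / ln 2 *
      (ln_double_primitive b (C + x) r + ln_double_primitive b (C + x) L
       - ln_double_primitive b x r - ln_double_primitive b x L))%:E)%E.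
Proof.
move=> C0 x0 b0 L0 r0; have Cx0 := addr_gt0 C0 x0.
pose F t := (2 / ln 2) *
  (ln_double_primitive b (C + x) (t - xi) - ln_double_primitive b x (t - xi)).
pose f t := 2 *
  (ln_primitive (C + x) (t - xi) b - ln_primitive x (t - xi) b) / ln 2.
have cf : continuous f by exact: continuous_ln_primitive_diff.
have dF (t : R) : is_derive t 1 F (f t).
  have dt : is_derive t 1 (fun y : R => y - xi) 1.
    by apply: is_derive_eq; rewrite subr0.
  have d1 := @is_derive1_comp _ (ln_double_primitive b (C + x)) (fun y => y - xi) _ _ _
    (is_derive_ln_double_primitive (t - xi) b0 Cx0) dt.
  have d2 := @is_derive1_comp _ (ln_double_primitive b x) (fun y => y - xi) _ _ _
    (is_derive_ln_double_primitive (t - xi) b0 x0) dt.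
  apply: is_derive_eq (is_derive_mul (is_derive_cst (2 / ln 2 : R) t 1)
    (is_deriveB d1 d2)) _.
  by rewrite /f /=; ring.
have Lr : xi - L < xi + r by lra.
rewrite (integral_is_derive Lr cf dF) /F.
have -> : xi + r - xi = r by ring.
have -> : xi - L - xi = - L by ring.
(* By oddness the lower end point contributes the value at [L] with a plus sign, so the left part
   enters just as the right one does. *)
rewrite !ln_double_primitiveN.
move: (ln_double_primitive b (C + x) r) (ln_double_primitive b (C + x) L).
move: (ln_double_primitive b x r) (ln_double_primitive b x L) => h1 h2 h3 h4.
by congr (_%:E)%E; ring.
Qed.

End rate_integrals.

(** * Expectations for a pair of independent uniform variables *)

Section uniform_pair.
Context {R : realType} {d : measure_display} {T : measurableType d}.
Variable P : probability T R.
Variables (X Y : {RV P >-> R}) (p q r t : R).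
Hypotheses (hX : uniformly_distributed X p q) (hY : uniformly_distributed Y r t).
Hypothesis XY_indep : independent_rv X Y.
Local Notation mu := (@lebesgue_measure R).

Lemma uniform_ae_in : \forall w \ae P, X w \in `[p, q].
Proof.
have [pq XE] := hX; exists (X @^-1` (~` `[p, q])); split.
- rewrite -[X in measurable X]setTI; apply: measurable_funPT => //.
  exact: measurableC.
- have := XE (~` `[p, q]); rewrite /distribution /pushforward => ->.
    by rewrite /uniform_prob integral_uniform_pdf setICl integral_set0.
  exact: measurableC.
by [].
Qed.

(** The uniform law is dominated by Lebesgue measure, for which points are null. This discards the
    common sides of the rectangles. *)
Lemma uniform_ae_neq a : \forall w \ae P, X w != a.
Proof.
have [pq XE] := hX; exists (X @^-1` [set a]); split.
- by rewrite -[X in measurable X]setTI; apply: measurable_funPT.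
- have := XE [set a]; rewrite /distribution /pushforward => -> //.
  have /null_content_dominatesP := dominates_uniform_prob pq.
  by apply => //; exact: lebesgue_measure_set1.
by move=> w /= /negP; rewrite negbK => /eqP.
Qed.

(** Independence makes the joint law a product of uniform laws, since both agree on measurable
    rectangles; Tonelli's theorem then gives an iterated integral whose two densities form the
    prefactor. *)
Lemma uniform_pair_integral (A : set R) (f : R * R -> R) (F : R -> R) :
  measurable A -> A `<=` `[p, q] ->
  measurable_fun setT f -> (forall z, 0 <= f z) ->
  measurable_fun setT F ->
  (forall x, \int[mu]_(y in `[r, t]) (f (x, y))%:E = (F x)%:E)%E ->
  (\int[P]_w (\1_A (X w) * f (X w, Y w))%:E =
   (((q - p) * (t - r))^-1)%:E * \int[mu]_(x in A) (F x)%:E)%E.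
Proof.
move=> mA Apq mf f0 mF fF; have [pq XE] := hX; have [rt YE] := hY.
(* uniform_prob is a measure on measurableTypeR R, whose display differs from
   the one of R although both have the same measurable sets. *)
pose TR : measurableType _ := measurableTypeR R.
have mXT : measurable_fun setT (X : T -> TR) := measurable_funPT X.
have mYT : measurable_fun setT (Y : T -> TR) := measurable_funPT Y.
pose XY w : TR * TR := (X w, Y w).
have mXY : measurable_fun setT XY by exact: measurable_fun_pair.
have mfT : measurable_fun setT (f : TR * TR -> R) := mf.
have mAT : measurable (A : set TR) := mA.
pose g (z : TR * TR) : \bar R := (\1_A z.1 * f z)%:E.
have mg : measurable_fun setT g.
  apply/measurable_EFinP; apply: measurable_funM => //.
  exact: (measurableT_comp (measurable_indic mAT)).
have g0 z : (0 <= g z)%E by rewrite lee_fin mulr_ge0.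
pose XYm : {RV P >-> (TR * TR)%type} :=
  HB.pack XY (isMeasurableFun.Build _ _ _ _ XY mXY).
transitivity (\int[distribution P XYm]_z g z)%E.
  by rewrite ge0_integral_distribution.
transitivity (\int[uniform_prob pq \x uniform_prob rt]_z g z)%E.
  apply: (@eq_measure_integral _ _ _ _ (uniform_prob pq \x uniform_prob rt)%E) => S mS _.
  apply/esym/product_measure_unique => // B C mB mC.
  transitivity (distribution P X B * distribution P Y C)%E.
    exact: XY_indep.
  by congr (_ * _)%E; [exact: XE|exact: YE].
have F0 x : 0 <= F x.
  by rewrite -lee_fin -fF; apply: integral_ge0 => y _; rewrite lee_fin.
rewrite fubini_tonelli1//.
have tr0 : (0 <= (t - r)^-1)%R by rewrite invr_ge0 subr_ge0 ltW.
pose G (x : TR) : \bar R := (\1_A x * ((t - r)^-1 * F x))%:E.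
have mG : measurable_fun setT G.
  apply/measurable_EFinP; apply: measurable_funM; first exact: measurable_indic.
  by apply: measurable_funM.
transitivity (\int[uniform_prob pq]_x G x)%E.
  apply: eq_integral => x _; rewrite /fubini_F /g/=.
  rewrite integral_uniform//; last 2 first.
  - exact: (measurable_fun_pair2 x mg).
  - by move=> y; exact: (g0 (x, y)).
  rewrite /G indicE; case: (x \in A).
    under eq_integral do rewrite mul1r.
    by rewrite fF -EFinM mul1r.
  under eq_integral do rewrite mul0r.
  by rewrite integral0 mule0 mul0r.
rewrite integral_uniform//; last by move=> x; rewrite lee_fin !mulr_ge0.
have -> : (\int[mu]_(x in `[p, q]) G x =
    ((t - r)^-1)%:E * \int[mu]_(x in A) (F x)%:E)%E.
  rewrite -ge0_integralZl//; last 2 first.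
  - exact/measurable_EFinP/measurable_funTS.
  - by move=> x _; rewrite lee_fin.
  rewrite -[in RHS](setIidr Apq) integral_mkcondr.
  apply: eq_integral => x _; rewrite patchE /G indicE.
  by case: (x \in A); rewrite ?mul1r ?mul0r.
by rewrite muleA -EFinM invfM.
Qed.

End uniform_pair.

(** * Geometry of the tiling *)

Section serving_rectangles.
Context {R : realType}.
Variables (Dx : R) (M : nat) (Le Ri : nat -> R).
Hypothesis tile : rectangles_tile Dx M Le Ri.
Local Notation x := (pa_pos Dx M).

Lemma rectangles_ordered j k : (1 <= j < k)%N -> (k <= M)%N ->
  x j + Ri j <= x k - Le k.
Proof.
have [LR0 _ adj _] := tile.
move=> /andP[j1]; elim: k => // k IH; rewrite ltnS leq_eqVlt => /predU1P[<-|jk] kM.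
  by rewrite adj// j1.
have k1 : (1 <= k)%N by exact: leq_trans (ltnW jk).
rewrite -adj ?k1//; apply: (le_trans (IH jk (ltnW kM))).
have [L0 R0] : 0 < Le k /\ 0 < Ri k by apply: LR0; rewrite k1 ltnW.
lra.
Qed.

(** Compare with the first and the last rectangle, whose outer sides are at 0 and [Dx];
    [rectangles_ordered] needs distinct indices, so [k = 1] and [k = M] are treated apart. *)
Lemma rectangle_in_area k : (1 <= k <= M)%N ->
  `[x k - Le k, x k + Ri k] `<=` `[0, Dx].
Proof.
have [LR0 lo _ hi] := tile.
move=> /[dup] kM /andP[k1 kM'] t; rewrite /= !in_itv/= => /andP[tl tr].
apply/andP; split.
  move: k1; rewrite leq_eqVlt => /predU1P[k1|k1]; first by move: tl; rewrite -k1 lo.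
  have [L0 R0] : 0 < Le 1%N /\ 0 < Ri 1%N.
    by apply: LR0; rewrite (leq_trans (ltnW k1) kM').
  have := @rectangles_ordered 1 k; rewrite k1 => /(_ erefl kM'); lra.
move: kM'; rewrite leq_eqVlt => /predU1P[kM'|kM']; first by move: tr; rewrite kM' hi.
have [L0 R0] : 0 < Le M /\ 0 < Ri M.
  by apply: LR0; rewrite leqnn andbT (leq_trans k1 (ltnW kM')).
have := @rectangles_ordered k M; rewrite k1 => /(_ kM' (leqnn M)); lra.
Qed.

(** Off its sides, [t] is interior to the rectangle [i] and thus outside every other closed one: a
    single indicator survives. *)
Lemma sum_over_rectangles (F : nat -> R) (i : nat) t : (1 <= i <= M)%N ->
  t \in `[x i - Le i, x i + Ri i] ->
  t != x i - Le i -> t != x i + Ri i ->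
  \sum_(1 <= k < M.+1) \1_`[x k - Le k, x k + Ri k] t * F k = F i.
Proof.
move=> /andP[i1 iM]; rewrite in_itv/= => /andP[tl tr] tnl tnr.
rewrite (bigD1_seq i) ?mem_index_iota ?iota_uniq ?i1 ?ltnS//=.
rewrite indicE mem_set ?mul1r; last by rewrite /= in_itv/= tl.
rewrite big1_seq ?addr0// => k /andP[ki]; rewrite mem_index_iota ltnS => /andP[k1 kM].
rewrite indicE memNset ?mul0r//= in_itv/= => /andP[ktl ktr].
have {}tl : x i - Le i < t by rewrite lt_neqAle eq_sym tnl.
have {}tr : t < x i + Ri i by rewrite lt_neqAle tnr.
have [ik|ik|/eqP] := ltngtP k i; last by rewrite (negbTE ki).
  have := @rectangles_ordered k i; rewrite k1 ik => /(_ erefl iM); lra.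
have := @rectangles_ordered i k; rewrite i1 ik => /(_ erefl kM); lra.
Qed.

End serving_rectangles.

(** * The rate of one antenna: measurability, sign and normalization *)

Section snr_rate.
Context {R : realType}.

(** The numerator [C] may vary with [w], as it does through the random serving index. *)
Lemma measurable_log2_snr_ratio {d} {T : measurableType d} (C f g : T -> R) x :
  measurable_fun setT C -> measurable_fun setT f -> measurable_fun setT g ->
  (forall w, 0 < C w) -> 0 < x ->
  measurable_fun setT (fun w => log2 (1 + C w / (f w ^+ 2 + g w ^+ 2 + x))).
Proof.
move=> mC mf mg C0 x0; under eq_fun do rewrite log2_snr_ratio//.
apply: measurable_funM => //; apply: measurable_funB.
  apply: (measurableT_comp (@measurable_ln R)).
  apply: measurable_funD; first by apply: measurable_funD; exact: measurable_funX.
  exact: measurable_funD.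
apply: (measurableT_comp (@measurable_ln R)).
by apply: measurable_funD => //; apply: measurable_funD; exact: measurable_funX.
Qed.

Lemma log2_snr_ratio_ge0 (C x u v : R) : 0 < C -> 0 < x ->
  0 <= log2 (1 + C / (u ^+ 2 + v ^+ 2 + x)).
Proof.
move=> C0 x0; rewrite /log2 divr_ge0// ?ln_ge0 ?ler1n//.
by rewrite lerDl divr_ge0 ?ltW// sum_sqr_gt0.
Qed.

Lemma snrE (eta Pt sigma2 alpha h xk u v : R) : 0 < sigma2 -> 0 < h ->
  snr eta Pt sigma2 alpha h xk u v =
  eta * Pt / sigma2 * expR (- alpha * xk) / ((u - xk) ^+ 2 + v ^+ 2 + h ^+ 2).
Proof.
move=> s0 h0; have N0 := sum_sqr_gt0 (u - xk) v (exprn_gt0 2 h0).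
by rewrite /snr; field; rewrite !gt_eqF.
Qed.

(** The corrections [2 * b * D] at [C0 + h ^+ 2] and at [h ^+ 2] cancel. *)
Lemma C_lE (b h C0 D : R) : 0 < b -> 0 < h -> 0 < C0 -> 0 < D ->
  D * C_l (2 * b) h C0 D = (b * ln 2)^-1 *
    (ln_double_primitive b (C0 + h ^+ 2) D - ln_double_primitive b (h ^+ 2) D).
Proof.
move=> b0 h0 C00 D0; have h2 : 0 < h ^+ 2 by rewrite exprn_gt0.
have ln2 : 0 < ln (2 : R) by rewrite ln_gt0// ltr1n.
have e1 := I_iD_I_jE b0 D0 (addr_gt0 C00 h2); have e2 := I_iD_I_jE b0 D0 h2.
rewrite /C_l -(addrA (_ + _)) -opprD e1 e2.
move: (ln_double_primitive b _ D) (ln_double_primitive b _ D) => H1 H2.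
by field; rewrite !gt_eqF.
Qed.

End snr_rate.

(** * The ergodic rate as a sum over antennas *)

Theorem proposition2 (R : realType)
  (Dx Dy h eta Pt sigma2 alpha : R) (M : nat) (Le Ri : nat -> R)
  (hDx : 0 < Dx) (hDy : 0 < Dy) (hh : 0 < h) (heta : 0 < eta) (hPt : 0 < Pt)
  (hsigma2 : 0 < sigma2) (halpha : 0 <= alpha) (hM : (1 <= M)%N)
  (htile : rectangles_tile Dx M Le Ri)
  (d : measure_display) (T : measurableType d) (P : probability T R)
  (xm ym : {RV P >-> R}) (s : {RV P >-> nat})
  (hxm : uniformly_distributed xm 0 Dx)
  (hym : uniformly_distributed ym (- (Dy / 2)) (Dy / 2))
  (hind : independent_rv xm ym)
  (hs : serving_index Dx Dy M Le Ri xm ym s) :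
  let x := pa_pos Dx M in
  let gamma := fun w : T =>
    snr eta Pt sigma2 alpha h (x (s w)) (xm w) (ym w) in
  let C := eta * Pt / sigma2 in
  let C0 := fun k : nat => C * expR (- alpha * x k) in
  ('E_P[fun w => log2 (1 + gamma w)])%E =
  (\sum_(1 <= k < M.+1)
     (Le k * C_l Dy h (C0 k) (Le k) / Dx
      + Ri k * C_l Dy h (C0 k) (Ri k) / Dx))%:E.
Proof.
move=> x gamma C C0.
have C0_gt0 k : 0 < C0 k by rewrite mulr_gt0 ?expR_gt0// divr_gt0// mulr_gt0.
have h2 : 0 < h ^+ 2 by rewrite exprn_gt0.
pose b := Dy / 2; have b0 : 0 < b by rewrite divr_gt0.
have DyE : Dy = 2 * b by rewrite /b mulrC divfK ?pnatr_eq0.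
pose rate k (z : R * R) :=
  log2 (1 + C0 k / ((z.1 - x k) ^+ 2 + z.2 ^+ 2 + h ^+ 2)).
pose A k : set R := `[x k - Le k, x k + Ri k]%classic.
have mA k : measurable (A k) by exact: measurable_itv.
have rate_ge0 k z : 0 <= rate k z by exact: log2_snr_ratio_ge0.
have m_rate k : measurable_fun setT (rate k).
  apply: measurable_log2_snr_ratio => //.
  by apply: measurable_funB.
have mZ k : measurable_fun setT (fun w => (\1_(A k) (xm w) * rate k (xm w, ym w))%:E).
  apply/measurable_EFinP; apply: measurable_funM.
    exact: (measurableT_comp (measurable_indic (mA k))).
  by apply: (measurableT_comp (m_rate k)); exact: measurable_fun_pair.
have gammaE w : log2 (1 + gamma w) = rate (s w) (xm w, ym w).
  by rewrite /gamma snrE.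
(* Almost surely the user is in the area and on no side abscissa, so only the indicator of [s w] is
   1. The random index thus gives way to a finite sum of nonnegative terms. *)
have split_ae : ae_eq P setT (fun w => (log2 (1 + gamma w))%:E)
    (fun w => (\sum_(1 <= k < M.+1) (\1_(A k) (xm w) * rate k (xm w, ym w))%:E)%E).
  have neL := ae_foralln (fun k => uniform_ae_neq hxm (x k - Le k)).
  have neR := ae_foralln (fun k => uniform_ae_neq hxm (x k + Ri k)).
  have H : \forall w \ae P,
      ((xm w \in `[0, Dx] /\ ym w \in `[(- (Dy / 2)), Dy / 2]) /\
      (forall k, xm w != x k - Le k)) /\ (forall k, xm w != x k + Ri k).
    apply: filterI neR; apply: filterI neL; apply: filterI.
      exact: uniform_ae_in.
    exact: uniform_ae_in.
  apply: filterS H.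
  move=> w [[[xin yin] nL] nR] _.
  have [sM [/= sA _]] := hs w (conj xin yin).
  by rewrite sumEFin (sum_over_rectangles htile (fun k => rate k (xm w, ym w)) sM)
    // gammaE.
rewrite unlock (ge0_ae_eq_integral measurableT _ _ _ _ split_ae)//; last 4 first.
- apply/measurable_EFinP; under eq_fun do rewrite gammaE.
  (* Every function on the discrete space [nat] is measurable. *)
  have mc (c : nat -> R) : measurable_fun setT (fun w => c (s w)).
    exact: (measurableT_comp (_ : measurable_fun setT c)).
  apply: (@measurable_log2_snr_ratio _ _ _ (fun w => C0 (s w))
    (fun w => xm w - x (s w)) ym) => //.
  by apply: measurable_funB => //; exact: (mc x).
- by apply: emeasurable_sum => k.
- by move=> w _; rewrite gammaE lee_fin.
- by move=> w _; apply: sume_ge0 => k _; rewrite lee_fin mulr_ge0.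
rewrite ge0_integral_sum//; last first.
  by move=> k w _; rewrite lee_fin mulr_ge0.
rewrite -sumEFin big_nat [RHS]big_nat; apply: eq_bigr => k kM.
pose F u := 2 * (ln_primitive (C0 k + h ^+ 2) (u - x k) b
  - ln_primitive (h ^+ 2) (u - x k) b) / ln 2.
rewrite (uniform_pair_integral hxm hym hind (F := F))//; last 3 first.
- exact: (rectangle_in_area htile).
- apply: continuous_measurable_fun; exact: continuous_ln_primitive_diff.
- by move=> u; rewrite /rate /= integral_log2_snr_ratio.
have [L0 R0] : 0 < Le k /\ 0 < Ri k by have [+ _ _ _] := htile; apply; rewrite -ltnS.
rewrite /F integral_ln_primitive_diff// -EFinM DyE !C_lE// -/b.
have ln2_gt0 : 0 < ln (2 : R) by rewrite ln_gt0// ltr1n.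
move: (ln_double_primitive b (C0 k + _) (Ri k)).
move: (ln_double_primitive b (C0 k + _) (Le k)).
move: (ln_double_primitive b _ (Ri k)) (ln_double_primitive b _ (Le k)).
move=> H1 H2 H3 H4; congr (_%:E)%E.
(* The area factor 1 / (2 b Dx) times 2 / ln 2 is 1 / (b Dx ln 2), the factor of [C_lE] divided by
   [Dx]. *)
by field; rewrite opprK !gt_eqF// addr_gt0.
Qed.
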